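(* Let $\mathcal{L}_0$ be a separable Hilbert space and $A:\mathcal{L}_0\to\mathcal{L}_0$ a contraction. Let $V_A$ be the unitary operator on $\mathcal{L}_0\times\mathcal{L}_0$ given by $$V_A=\begin{pmatrix}A&(1-AA^* )^{1/2}\\(1-A^*A)^{1/2}&-A^*\end{pmatrix}.$$ Then $A$ is Schmidt decomposable if and only if $\begin{pmatrix}0&1\\1&0\end{pmatrix}V_A$ is diagonalizable.
   Context: A contraction is a linear operator with $\|A\|\le1$. An operator is diagonalizable if there is an orthonormal basis of the space consisting of its eigenvectors. A bounded operator $T$ is Schmidt decomposable if it has a singular value decomposition: there exist (finite or countable) orthonormal systems $\{f_n\}_{n\ge1}$, $\{g_n\}_{n\ge1}$ and positive numbers $s_n$ such that $T=\sum_{n\ge1}s_n\,f_n\otimes g_n$ (strong convergence), where $(f\otimes g)(h)=\langle h,g\rangle f$. *)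

(* Defs.v *)
From HB Require Import structures.
From mathcomp Require Import all_boot all_order all_algebra sesquilinear.
From mathcomp Require Import complex ring.
From mathcomp Require Import boolp classical_sets functions cardinality reals.
From mathcomp Require Import ereal topology normedtype sequences.

Set Implicit Arguments.
Unset Strict Implicit.
Unset Printing Implicit Defensive.

Import Order.TTheory GRing.Theory Num.Theory.
Import numFieldNormedType.Exports.

Local Open Scope classical_set_scope.
Local Open Scope ring_scope.
Local Open Scope complex_scope.

(* Complex Hilbert spaces.  As in [{dot V for conjC}], the inner product is
   linear in its first argument and conjugate-linear in the second one. *)
HB.mixin Record CompleteNormedModule_isHilbert (R : realType) V
    & CompleteNormedModule R[i] V := {
  hdot : {dot V for (@Num.conj R[i])} ;
  hdot_norm : forall x : V, `|x| ^+ 2 = hdot x x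
}.

#[short(type="hilbertType")]
HB.structure Definition Hilbert (R : realType) :=
  {V of CompleteNormedModule R[i] V & CompleteNormedModule_isHilbert R V}.

Notation "'<| x , y |>" := (hdot x y) : ring_scope.

(* Orthogonal direct sum: the product space with the Hilbert norm, and not the
   sup norm that [V * W] carries. *)
Definition hsum (R : realType) (V W : hilbertType R) : Type := (V * W)%type.

Section HilbertSum.
Variables (R : realType) (V W : hilbertType R).
Local Notation C := R[i].

HB.instance Definition _ := GRing.Lmodule.copy (hsum V W) (V * W)%type.

Let hsum_norm (z : hsum V W) : C := sqrtC (`|z.1| ^+ 2 + `|z.2| ^+ 2).

Let hsum_norm_ge0 z : 0 <= hsum_norm z.
Proof. by rewrite sqrtC_ge0 addr_ge0// exprn_ge0. Qed.

Let minkowski (a b c d : C) : 0 <= a -> 0 <= b -> 0 <= c -> 0 <= d ->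
  sqrtC ((a + c) ^+ 2 + (b + d) ^+ 2) <=
  sqrtC (a ^+ 2 + b ^+ 2) + sqrtC (c ^+ 2 + d ^+ 2).
Proof.
move=> a0 b0 c0 d0.
have nn (x y : C) : 0 <= x -> 0 <= y -> 0 <= x ^+ 2 + y ^+ 2.
  by move=> x0 y0; rewrite addr_ge0// exprn_ge0.
rewrite -ler_sqr ?nnegrE ?addr_ge0 ?sqrtC_ge0 ?nn ?addr_ge0//.
rewrite [leRHS]sqrrD !sqrtCK.
have cs : a * c + b * d <= sqrtC (a ^+ 2 + b ^+ 2) * sqrtC (c ^+ 2 + d ^+ 2).
  rewrite -ler_sqr ?nnegrE ?mulr_ge0 ?sqrtC_ge0 ?nn ?addr_ge0 ?mulr_ge0//.
  rewrite exprMn !sqrtCK -subr_ge0.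
  rewrite (_ : _ - _ = (a * d - b * c) ^+ 2); last by ring.
  by rewrite real_exprn_even_ge0// rpredB ?rpredM ?ger0_real.
rewrite -subr_ge0.
set p := sqrtC _ * _ in cs *.
rewrite (_ : _ - _ = (p - (a * c + b * d)) *+ 2); last by ring.
by rewrite mulrn_wge0 // subr_ge0.
Qed.

Let hsum_ler_normD x y : hsum_norm (x + y) <= hsum_norm x + hsum_norm y.
Proof.
apply: le_trans (minkowski _ _ _ _) => //.
rewrite ler_sqrtC ?qualifE /= ?addr_ge0 ?exprn_ge0 ?addr_ge0//.
by rewrite lerD// ler_sqr ?nnegrE ?addr_ge0// ler_normD.
Qed.

Let hsum_normrZ (l : C) x : hsum_norm (l *: x) = `|l| * hsum_norm x.
Proof.
rewrite /hsum_norm /= !normrZ !exprMn -mulrDr sqrtCM ?qualifE /=.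
- by rewrite sqrCK.
- exact: exprn_ge0.
- by rewrite addr_ge0// exprn_ge0.
Qed.

Let hsum_normr0_eq0 x : hsum_norm x = 0 -> x = 0.
Proof.
move/eqP; rewrite sqrtC_eq0 paddr_eq0 ?exprn_ge0// !expf_eq0 /= !normr_eq0.
by case: x => x y /= /andP[/eqP-> /eqP->].
Qed.

HB.instance Definition _ := Lmodule_isNormed.Build C (hsum V W)
  hsum_ler_normD hsum_normrZ hsum_normr0_eq0.

Lemma hsum_normE (z : hsum V W) : `|z| = sqrtC (`|z.1| ^+ 2 + `|z.2| ^+ 2).
Proof. by []. Qed.

Let hsum_norm1 (z : hsum V W) : `|z.1| <= `|z|.
Proof.
rewrite hsum_normE -[leLHS]sqrCK// ler_sqrtC ?qualifE /= ?addr_ge0 ?exprn_ge0//.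
by rewrite lerDl exprn_ge0.
Qed.

Let hsum_norm2 (z : hsum V W) : `|z.2| <= `|z|.
Proof.
rewrite hsum_normE -[leLHS]sqrCK// ler_sqrtC ?qualifE /= ?addr_ge0 ?exprn_ge0//.
by rewrite lerDr exprn_ge0.
Qed.

Let hsum_norm_le (z : hsum V W) : `|z| <= `|z.1| + `|z.2|.
Proof.
rewrite hsum_normE -[leRHS]sqrCK ?addr_ge0//.
rewrite ler_sqrtC ?qualifE /= ?addr_ge0 ?exprn_ge0 ?addr_ge0//.
by rewrite sqrrD addrAC lerDl mulrn_wge0// mulr_ge0.
Qed.

Let hsum_complete (F : set_system (hsum V W)) :
  ProperFilter F -> cauchy F -> cvg F.
Proof.
move=> FF /cauchy_ballP F_cauchy.
have cvg1 : cvg ((fun z : hsum V W => z.1) @ F).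
  apply: cauchy_cvg; apply/cauchy_ballP => e e0.
  have [[A B] /= [FA FB] AB] := F_cauchy e e0.
  exists ((fun z : hsum V W => z.1) @` A, (fun z : hsum V W => z.1) @` B).
    by split; [apply: filterS FA|apply: filterS FB] => z Az; exists z.
  move=> [_ _] [/= [z Az <-] [t Bt <-]].
  have := AB (z, t) (conj Az Bt).
  rewrite -!ball_normE /ball_ /=; apply: le_lt_trans.
  exact: (hsum_norm1 (z - t)).
have cvg2 : cvg ((fun z : hsum V W => z.2) @ F).
  apply: cauchy_cvg; apply/cauchy_ballP => e e0.
  have [[A B] /= [FA FB] AB] := F_cauchy e e0.
  exists ((fun z : hsum V W => z.2) @` A, (fun z : hsum V W => z.2) @` B).
    by split; [apply: filterS FA|apply: filterS FB] => z Az; exists z.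
  move=> [_ _] [/= [z Az <-] [t Bt <-]].
  have := AB (z, t) (conj Az Bt).
  rewrite -!ball_normE /ball_ /=; apply: le_lt_trans.
  exact: (hsum_norm2 (z - t)).
apply/cvg_ex; exists ((lim ((fun z : hsum V W => z.1) @ F),
  lim ((fun z : hsum V W => z.2) @ F)) : hsum V W).
apply/cvgrPdist_lt => e e0; near=> z.
apply: le_lt_trans (hsum_norm_le _) _ => /=.
rewrite [ltRHS]splitr ltrD//.
- by near: z; move/cvgrPdist_lt : cvg1; apply; rewrite divr_gt0.
- by near: z; move/cvgrPdist_lt : cvg2; apply; rewrite divr_gt0.
Unshelve. all: by end_near. Qed.

HB.instance Definition _ :=
  Uniform_isComplete.Build (hsum V W) hsum_complete.

Definition hsum_dot (z t : hsum V W) : C := '<| z.1, t.1 |> + '<| z.2, t.2 |>.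

Let hsum_dot_bilinear : bilinear_for *%R (Num.conj \; *%R) hsum_dot.
Proof.
split=> u a x y; rewrite /hsum_dot /=.
  by rewrite !linearPl mulrDr addrACA.
by rewrite !linearPr /= mulrDr addrACA.
Qed.

HB.instance Definition _ := bilinear_isBilinear.Build C (hsum V W) (hsum V W) C
  *%R (Num.conj \; *%R) hsum_dot hsum_dot_bilinear.
Let hsum_dotC z t : hsum_dot z t = (-1) ^+ false * Num.conj (hsum_dot t z).
Proof.
rewrite expr0 mul1r /hsum_dot rmorphD /=.
by congr (_ + _); rewrite hermC /= expr0 mul1r.
Qed.

HB.instance Definition _ := isHermitianSesquilinear.Build C (hsum V W)
  false Num.conj hsum_dot hsum_dotC.

Let hsum_dot_norm (z : hsum V W) : `|z| ^+ 2 = hsum_dot z z.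
Proof. by rewrite hsum_normE sqrtCK !hdot_norm. Qed.

Let hsum_dot_gt0 (z : hsum V W) : z != 0 -> 0 < hsum_dot z z.
Proof. by move=> z0; rewrite -hsum_dot_norm exprn_gt0// normr_gt0. Qed.

HB.instance Definition _ := isDotProduct.Build C (hsum V W) hsum_dot
  hsum_dot_gt0.

HB.instance Definition _ := CompleteNormedModule_isHilbert.Build R (hsum V W)
  hsum_dot_norm.

End HilbertSum.

Section Operators.
Variables (R : realType).
Local Notation C := R[i].

(* Operator norm; infinite when [T] is unbounded. *)
Definition opnorm (V W : hilbertType R) (T : V -> W) : \bar R :=
  ereal_sup [set (complex.Re `|T x|)%:E | x in [set x : V | `|x| <= 1]].

Definition contraction_operator (V W : hilbertType R) (T : V -> W) :=
  (opnorm T <= 1)%E.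

(* [adjoint T y] is the vector [z] such that '<| T x, y |> = '<| x, z |> for
   every [x]; it exists, by the Riesz representation theorem, when [T] is
   linear and bounded. *)
Definition adjoint (V W : hilbertType R) (T : V -> W) (y : W) : V :=
  get [set z | forall x, '<| T x, y |> = '<| x, z |>].

Definition positive_operator (V : hilbertType R) (T : V -> V) :=
  [/\ linear T, continuous T & forall x, 0 <= '<| T x, x |>].

(* The positive square root, when [T] is a positive operator. *)
Definition opsqrt (V : hilbertType R) (T : V -> V) : V -> V :=
  get [set S | positive_operator S /\ S \o S = T].

Definition block_operator (V1 V2 W1 W2 : hilbertType R)
    (T11 : V1 -> W1) (T12 : V2 -> W1) (T21 : V1 -> W2) (T22 : V2 -> W2)
    (z : hsum V1 V2) : hsum W1 W2 :=
  (T11 z.1 + T12 z.2, T21 z.1 + T22 z.2).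

(* Unitary when [A] is a linear contraction. *)
Definition julia_operator (V : hilbertType R) (A : V -> V) :
    hsum V V -> hsum V V :=
  block_operator A (opsqrt (idfun \- (A \o adjoint A)))
                 (opsqrt (idfun \- (adjoint A \o A))) (\- adjoint A).

Definition flip_operator (V : hilbertType R) : hsum V V -> hsum V V :=
  block_operator (fun=> 0) idfun idfun (fun=> 0).

(* [(f n)_(n in D)]; a set [E] is viewed as the family [(id x)_(x in E)]. *)
Definition orthonormal_family (V : hilbertType R) (I : eqType) (D : set I)
    (f : I -> V) :=
  forall m n, D m -> D n -> '<| f m, f n |> = (m == n)%:R.

Definition lspan (V : hilbertType R) (E : set V) : set V :=
  [set x | exists (n : nat) (c : 'I_n -> C) (e : 'I_n -> V),
     (forall i, E (e i)) /\ x = \sum_i c i *: e i].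

Definition orthonormal_basis (V : hilbertType R) (E : set V) :=
  orthonormal_family E id /\ dense (lspan E).

Definition eigenvector (V : hilbertType R) (T : V -> V) : set V :=
  [set x | x != 0 /\ exists a : C, T x = a *: x].

Definition diagonalizable_operator (V : hilbertType R) (T : V -> V) :=
  exists E : set V, orthonormal_basis E /\ E `<=` eigenvector T.

Definition rank1 (V W : hilbertType R) (f : W) (g : V) : V -> W :=
  fun h => '<| h, g |> *: f.

(* A finite or countable system is a family indexed by a subset of [nat]. *)
Definition schmidt_decomposable (V W : hilbertType R) (T : V -> W) :=
  exists (D : set nat) (s : nat -> R) (f : nat -> W) (g : nat -> V),
    [/\ orthonormal_family D f, orthonormal_family D g,
        forall n, D n -> 0 < s n
      & forall h, (\sum_(0 <= n < N | n \in D)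
                     ((s n)%:C *: rank1 (f n) (g n) h))
                  @[N --> \oo] --> T h].

Definition separable_space (T : topologicalType) :=
  exists2 D : set T, countable D & dense D.

End Operators.

Arguments flip_operator {R} V _.

(* Main.v *)
Require Import Defs.
From HB Require Import structures.
From mathcomp Require Import all_boot all_order all_algebra complex sesquilinear.
From mathcomp Require Import ring lra.
From mathcomp Require Import boolp classical_sets functions cardinality reals.
From mathcomp Require Import ereal topology normedtype sequences.

Set Implicit Arguments.
Unset Strict Implicit.
Unset Printing Implicit Defensive.

Import Order.TTheory GRing.Theory Num.Theory.
Import numFieldNormedType.Exports.

Local Open Scope classical_set_scope.
Local Open Scope ring_scope.
Local Open Scope complex_scope.

(** Let [B] be the adjoint of [A], and write [D = (1 - B A)^(1/2)] and
    [D' = (1 - A B)^(1/2)].  Exchanging the two copies of the space turns the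
    Julia operator into [U (x, y) = (D x - B y, A x + D' y)], whose real part is
    the direct sum of [D] and [D'].

    If [A] is the sum of the operators [s_n <., g_n> f_n], then
    [A g_n = s_n f_n] and [B f_n = s_n g_n], so [U] acts on the span of
    [(g_n, 0)] and [(0, f_n)] as a rotation, with eigenvectors [(g_n, - i f_n)]
    and [(g_n, i f_n)], while it fixes [(x, 0)] for [x] in the kernel of [A] and
    [(0, y)] for [y] in the kernel of [B].  These are eigenvectors of both [U]
    and its adjoint ([singular_pair_eigenvector]), and only zero is orthogonal
    to all of them.  That is enough for an orthonormal basis of eigenvectors
    ([orthonormal_eigenbasis]): the orthogonal complement of a set of joint
    eigenvectors of [U] and its adjoint is invariant under both operators, so a
    maximal orthonormal set of joint eigenvectors is a basis.

    Conversely, an orthonormal basis of eigenvectors of [U] diagonalises the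
    adjoint of [U], hence also the real part of [U].  So the first component of
    a basis vector is zero or an eigenvector of [D], and therefore of
    [B A = 1 - D^2] ([eigenbasis_AadjA]).  These components are total, hence
    [B A] has an orthonormal basis of eigenvectors, which is countable because
    the space is separable.  Keeping the basis vectors [g] with [A g <> 0] and
    setting [s = |A g|] and [f = A g / s] gives the decomposition: applying [A]
    to the Fourier series of [h] produces its Schmidt series.

    The square roots enter through two facts: they exist
    ([positive_sqrt_ex]), and an eigenvector of the square of a positive
    operator for [c^2], with [c >= 0], is an eigenvector of that operator for
    [c] ([positive_sqrt_eigen]).  Existence for [1 - K] comes from the iteration
    [Y_(n+1) = (K + Y_n^2) / 2], whose limit [Y] satisfies
    [(1 - Y)^2 = 1 - K].  The adjoint comes from the projection theorem
    ([orthogonal_projection]) through Riesz representation. *)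

(** * Inner products *)

Section InnerProduct.
Variables (R : realType) (V : hilbertType R).
Local Notation C := R[i].
Implicit Types (x y z : V) (a : C).

Lemma hdotC x y : '<| x, y |> = Num.conj '<| y, x |>.
Proof. by rewrite [LHS]hermC expr0 mul1r. Qed.

Lemma hdotDl x y z : '<| x + y, z |> = '<| x, z |> + '<| y, z |>.
Proof. exact: linearDl. Qed.

Lemma hdotDr x y z : '<| z, x + y |> = '<| z, x |> + '<| z, y |>.
Proof. exact: linearDr. Qed.

Lemma hdotBl x y z : '<| x - y, z |> = '<| x, z |> - '<| y, z |>.
Proof. exact: linearBl. Qed.

Lemma hdotBr x y z : '<| z, x - y |> = '<| z, x |> - '<| z, y |>.
Proof. exact: linearBr. Qed.

Lemma hdotNl x y : '<| - x, y |> = - '<| x, y |>.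
Proof. exact: linearNl. Qed.

Lemma hdotNr x y : '<| x, - y |> = - '<| x, y |>.
Proof. exact: linearNr. Qed.

Lemma hdotZl a x y : '<| a *: x, y |> = a * '<| x, y |>.
Proof. exact: linearZl_LR. Qed.

Lemma hdotZr a x y : '<| x, a *: y |> = Num.conj a * '<| x, y |>.
Proof. exact: linearZr_LR. Qed.

Lemma hdot0l x : '<| 0, x |> = 0.
Proof. exact: linear0l. Qed.

Lemma hdot0r x : '<| x, 0 |> = 0.
Proof. exact: linear0r. Qed.

Lemma hdot_suml (I : Type) (r : seq I) (P : pred I) (F : I -> V) y :
  '<| \sum_(i <- r | P i) F i, y |> = \sum_(i <- r | P i) '<| F i, y |>.
Proof. exact: linear_sumlz. Qed.

Lemma hdot_eq0C x y : '<| x, y |> = 0 -> '<| y, x |> = 0.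
Proof. by move=> xy0; rewrite hdotC xy0 rmorph0. Qed.

Lemma hdot_ge0 x : 0 <= '<| x, x |>.
Proof. by rewrite -hdot_norm exprn_ge0. Qed.

Lemma hdot_eq0 x : '<| x, x |> = 0 -> x = 0.
Proof.
by rewrite -hdot_norm => /eqP; rewrite expf_eq0 /= normr_eq0 => /eqP.
Qed.

Lemma hdot_inj x y : (forall z, '<| x, z |> = '<| y, z |>) -> x = y.
Proof.
move=> xy; apply/eqP; rewrite -subr_eq0; apply/eqP/hdot_eq0.
by rewrite hdotBl xy subrr.
Qed.

Lemma hdot_injr x y : (forall z, '<| z, x |> = '<| z, y |>) -> x = y.
Proof. by move=> xy; apply: hdot_inj => z; rewrite hdotC xy -hdotC. Qed.

Lemma cauchy_schwarz x y : `|'<| x, y |>| <= `|x| * `|y|.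
Proof.
have [->|y0] := eqVneq y 0; first by rewrite hdot0r !normr0 mulr0.
rewrite -ler_sqr ?nnegrE ?mulr_ge0// exprMn !hdot_norm normCK -hdotC.
have yy0 : 0 < '<| y, y |> by rewrite -hdot_norm exprn_gt0 ?normr_gt0.
rewrite -subr_ge0 -(pmulr_rge0 _ yy0).
rewrite (_ : _ * _ = '<| '<| y, y |> *: x - '<| x, y |> *: y,
                       '<| y, y |> *: x - '<| x, y |> *: y |>) ?hdot_ge0//.
rewrite !(hdotBl, hdotBr, hdotZl, hdotZr) -!hdotC; ring.
Qed.

Lemma pythagoras x y : '<| x, y |> = 0 ->
  `|x + y| ^+ 2 = `|x| ^+ 2 + `|y| ^+ 2.
Proof.
move=> xy; rewrite !hdot_norm !(hdotDl, hdotDr) xy (hdot_eq0C xy).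
by rewrite addr0 add0r.
Qed.

Lemma parallelogram x y :
  `|x - y| ^+ 2 = 2 * `|x| ^+ 2 + 2 * `|y| ^+ 2 - 4 * `|2^-1 *: (x + y)| ^+ 2.
Proof.
rewrite normrZ exprMn !hdot_norm !(hdotDl, hdotDr, hdotNl, hdotNr).
rewrite ger0_norm ?invr_ge0 ?ler0n//; by field.
Qed.

End InnerProduct.

(** * Orthogonal projection *)

Section Projection.
Variables (R : realType) (V : hilbertType R).
Local Notation C := R[i].
Implicit Types (x y z : V) (a : C).

Lemma RRe_gt0 (e : C) : 0 < e -> (complex.Re e)%:C = e.
Proof. by move=> e0; rewrite RRe_real// gtr0_real. Qed.

Lemma normr_small_eq0 (k c : C) : 0 <= k ->
  (forall e : C, 0 < e -> `|c| <= e * k) -> c = 0.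
Proof.
move=> k0 ce; apply/eqP; rewrite -normr_eq0 -[_ == _]negbK -normr_gt0 normr_id.
apply/negP => c0; have k1 : 0 < k + 1 by rewrite ltr_wpDl.
have := ce (`|c| / (k + 1)) (divr_gt0 c0 k1).
rewrite mulrAC ler_pdivlMr// ler_pM2l// gerDl => /le_gtF.
by rewrite ltr01.
Qed.

Lemma cvg_lipschitz (W : normedModType C) (f : V -> W) (k : C)
    (u : nat -> V) x :
  (forall y z, `|f y - f z| <= k * `|y - z|) ->
  u @ \oo --> x -> (f \o u) @ \oo --> f x.
Proof.
move=> fk ux; apply/cvgrPdist_lt => e e0.
(* [k] itself could vanish, and is divided by below. *)
have k1 : 0 < `|k| + 1 by rewrite ltr_wpDl.
near=> n; apply: le_lt_trans (fk _ _) _.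
apply: (@le_lt_trans _ _ ((`|k| + 1) * `|x - u n|)).
  have xu0 := normr_ge0 (x - u n).
  rewrite -[leLHS]ger0_norm; last first.
    have := fk x (u n); have := normr_ge0 (f x - f (u n)); exact: le_trans.
  by rewrite normrM normr_id ler_wpM2r// lerDl.
rewrite -ltr_pdivlMl// mulrC.
by near: n; move/cvgrPdist_lt : ux; apply; rewrite divr_gt0.
Unshelve. all: by end_near. Qed.

Lemma closure_dist (M : set V) x (e : C) : closure M x -> 0 < e ->
  exists2 m, M m & `|x - m| < e.
Proof.
move=> Mx e0; have [m [Mm xm]] := Mx _ (nbhsx_ballx x e e0).
by exists m => //; rewrite -ball_normE in xm.
Qed.

Lemma dist_closure (M : set V) x :
  (forall e : C, 0 < e -> exists2 m, M m & `|x - m| < e) -> closure M x.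
Proof.
move=> Mx B /nbhs_ballP[e /= e0 eB]; have [m Mm xm] := Mx e e0.
by exists m; split=> //; apply: eB; rewrite -ball_normE.
Qed.

Lemma closure_ker (f : V -> C) (k : C) (M : set V) x : 0 <= k ->
  (forall y z, `|f y - f z| <= k * `|y - z|) ->
  M `<=` [set y | f y = 0] -> closure M x -> f x = 0.
Proof.
move=> k0 fk M0 Mx; apply: (@normr_small_eq0 k) => // e e0.
have [m /M0/= fm0 /ltW xm] := closure_dist Mx e0.
by rewrite -[f x]subr0 -fm0; apply: le_trans (fk _ _) _; rewrite mulrC ler_wpM2r.
Qed.

Lemma hdot_lipschitz y x z :
  `|'<| x, y |> - '<| z, y |>| <= `|y| * `|x - z|.
Proof. by rewrite -hdotBl mulrC cauchy_schwarz. Qed.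

Lemma hdot_lipschitzr y x z :
  `|'<| y, x |> - '<| y, z |>| <= `|y| * `|x - z|.
Proof. by rewrite -hdotBr cauchy_schwarz. Qed.

Lemma closure_orth (M : set V) x y :
  (forall m, M m -> '<| m, y |> = 0) -> closure M x -> '<| x, y |> = 0.
Proof. by move=> My; apply: closure_ker (hdot_lipschitz y) _. Qed.

Lemma cauchy_seq_cvg (u : nat -> V) :
  (forall e : C, 0 < e ->
    exists N, forall m n, (N <= m)%N -> (N <= n)%N -> `|u m - u n| < e) ->
  cvgn u.
Proof.
move=> u_cauchy; apply: cauchy_cvg; apply/cauchy_ballP => e e0.
have [N uN] := u_cauchy e e0.
exists (u @` [set n | (N <= n)%N], u @` [set n | (N <= n)%N]) => /=.
  by split; exists N => // n Nn; exists n.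
by move=> [_ _] [/= [m Nm <-] [n Nn <-]]; rewrite -ball_normE; apply: uN.
Qed.

Let sqdist x (m : V) : R := complex.Re (`|x - m| ^+ 2).

Let sqdistE x m : (sqdist x m)%:C = `|x - m| ^+ 2.
Proof. by rewrite /sqdist RRe_real// ger0_real// exprn_ge0. Qed.

Section Subspace.
Variable M : set V.
Hypotheses (M0 : M 0) (M_lin : forall a x y, M x -> M y -> M (a *: x + y)).

(** Moving [m] in the direction of [v] by the optimal amount
    [<x - m, v> / |v|^2] lowers the squared distance to [x] by
    [|<x - m, v>|^2 / |v|^2], which cannot exceed the slack [e]. *)
Lemma near_minimizer_orth x m v (d e : R) : M m -> M v ->
  (forall m', M m' -> d <= sqdist x m') -> sqdist x m < d + e ->
  `|'<| x - m, v |>| ^+ 2 <= e%:C * `|v| ^+ 2.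
Proof.
move=> Mm Mv d_min md.
have [->|v0] := eqVneq v 0.
  by rewrite hdot0r !normr0 expr0n mulr0.
have vv0 : 0 < '<| v, v |> by rewrite -hdot_norm exprn_gt0 ?normr_gt0.
pose w := x - m; pose c := '<| w, v |>; pose t := c / '<| v, v |>.
have := d_min _ (M_lin t Mv Mm); rewrite -lecR sqdistE => dt.
have {}md : `|x - m| ^+ 2 <= d%:C + e%:C by rewrite -sqdistE -raddfD/= lecR ltW.
have := le_trans md (lerD dt (lexx e%:C)).
rewrite (_ : x - (t *: v + m) = (x - m) - t *: v); last first.
  by rewrite [t *: v + m]addrC opprD addrA.
rewrite -/w; clearbody w; move: md => _.
rewrite !hdot_norm !(hdotBl, hdotBr, hdotZl, hdotZr).
rewrite -/c (hdotC v w) -/c.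
have -> : Num.conj t = Num.conj c / '<| v, v |>.
  by rewrite /t rmorphM fmorphV /= -(hdotC v v).
rewrite -/c normCK -[X in _ <= X -> _]addrC -subr_ge0 => le1.
rewrite -subr_ge0.
have -> : e%:C * '<| v, v |> - c * Num.conj c =
  '<| v, v |> * (e%:C - c / '<| v, v |> * Num.conj c).
  by field; rewrite gt_eqF.
rewrite mulr_ge0 ?(ltW vv0)//; apply: le_trans le1 _.
rewrite le_eqVlt; apply/orP; left; apply/eqP; rewrite /t; field.
by rewrite gt_eqF.
Qed.

(** Minimising sequences for the distance from [x] to [M] are Cauchy by the
    parallelogram law, and the error of an almost-minimiser is almost
    orthogonal to [M].  Since [M] need not be closed, the foot of the
    perpendicular is only found in its closure. *)
Lemma orthogonal_projection x :
  exists2 p, closure M p & forall v, M v -> '<| x - p, v |> = 0.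
Proof.
pose S := [set sqdist x m | m in M].
have S_inf : has_inf S.
  split; first by exists (sqdist x 0), 0.
  by exists 0 => _ [m _ <-]; rewrite -lecR sqdistE exprn_ge0.
pose d := inf S.
have d_min m : M m -> d <= sqdist x m.
  by move=> Mm; apply: ge_inf; [case: S_inf|exists m].
have /choice[u uP] : forall n : nat, exists m,
    M m /\ sqdist x m < d + n.+1%:R^-1.
  move=> n; have n0 : 0 < n.+1%:R^-1 :> R by rewrite invr_gt0.
  by have [_ [m Mm <-] md] := inf_adherent n0 S_inf; exists m.
have u_close (r : R) : 0 < r -> exists N, forall n, (N <= n)%N ->
    sqdist x (u n) < d + r.
  move=> r0; have [N _ NP] := near_infty_natSinv_lt (PosNum r0).
  exists N => n Nn; apply: lt_trans (uP n).2 _.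
  by rewrite ltrD2l; exact: NP.
have u_cvg : cvgn u.
  apply: cauchy_seq_cvg => e e0; pose r := complex.Re e.
  have r0 : 0 < r by rewrite -ltcR RRe_gt0.
  have [N NP] := u_close (r ^+ 2 / 4) (divr_gt0 (exprn_gt0 2 r0) (ltr0n _ 4)).
  exists N => m n Nm Nn.
  rewrite -ltr_sqr ?nnegrE ?(ltW e0)//.
  have := d_min _ (M_lin 2^-1 (uP m).1 (M_lin 2^-1 (uP n).1 M0)).
  rewrite addr0 -scalerDr => d_mid.
  have := parallelogram (x - u n) (x - u m).
  have -> : x - u n - (x - u m) = u m - u n by rewrite opprB addrC subrKA.
  have -> : 2^-1 *: (x - u n + (x - u m)) = x - 2^-1 *: (u m + u n).
    rewrite addrACA -opprD [u n + u m]addrC scalerBr; congr (_ - _).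
    by rewrite -mulr2n -[x *+ 2]scaler_nat scalerA mulVf ?scale1r// pnatr_eq0.
  rewrite -!sqdistE => ->.
  have -> (a b c : R) : 2 * a%:C + 2 * b%:C - 4 * c%:C =
      (2 * a + 2 * b - 4 * c)%:C.
    by rewrite rmorphB rmorphD !rmorphM !rmorph_nat.
  rewrite -(RRe_gt0 e0) -/r -(rmorphXn (real_complex R)) ltcR.
  by have := NP m Nm; have := NP n Nn; lra.
have u_lim : u @ \oo --> lim (u @ \oo) by [].
exists (lim (u @ \oo)).
  apply: dist_closure => e e0.
  move/cvgrPdist_lt/(_ e e0) : u_lim => [n _ /(_ n (leqnn n)) un].
  by exists (u n) => //; exact: (uP n).1.
move=> v Mv; apply: (@normr_small_eq0 (2 * `|v|)) => [|e e0].
  by rewrite mulr_ge0.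
pose r := complex.Re e; have r0 : 0 < r by rewrite -ltcR RRe_gt0.
have [N NP] := u_close (r ^+ 2) (exprn_gt0 2 r0).
move/cvgrPdist_lt/(_ e e0) : u_lim => [K _ KP].
pose n := maxn N K; have Nn := leq_maxl N K.
have {KP}/ltW un := KP n (leq_maxr N K).
rewrite (_ : x - _ = (x - u n) - (lim (u @ \oo) - u n)); last first.
  by rewrite opprB addrC subrKA addrC.
rewrite hdotBl; apply: le_trans (ler_normB _ _) _.
rewrite [e * _](_ : _ = e * `|v| + e * `|v|); last by rewrite mulrCA mulr_natl.
apply: lerD.
  have := near_minimizer_orth (uP n).1 Mv d_min (NP n Nn).
  rewrite (rmorphXn (real_complex R)) /= /r RRe_gt0// -exprMn.
  by rewrite ler_sqr// nnegrE ?mulr_ge0// ltW.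
by apply: le_trans (cauchy_schwarz _ _) _; rewrite ler_wpM2r.
Qed.

End Subspace.

End Projection.

(** * Bounded operators, adjoints and positive operators *)

Section LinearMaps.
Variables (R : realType) (V W : hilbertType R).
Local Notation C := R[i].

(** Square roots and adjoints are produced as bare functions; this gives them
    access to the rewriting rules for linear maps. *)
Lemma linear_fun_ex (T : V -> W) : linear T ->
  exists T' : {linear V -> W}, T = T'.
Proof.
move=> Tlin; pose mT := GRing.isLinear.Build C V W *:%R T Tlin.
pose T' : {linear V -> W} := HB.pack T mT.
by exists T'.
Qed.

Definition nonexpansive (T : V -> W) := forall x, `|T x| <= `|x|.

Lemma nonexpansive_lipschitz (T : {linear V -> W}) : nonexpansive T ->
  forall x y, `|T x - T y| <= 1 * `|x - y|.
Proof. by move=> T1 x y; rewrite -linearB mul1r. Qed.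

Lemma nonexpansive_cvg (T : {linear V -> W}) (u : nat -> V) x :
  nonexpansive T -> u @ \oo --> x -> (T \o u) @ \oo --> T x.
Proof. by move=> /nonexpansive_lipschitz; exact: cvg_lipschitz. Qed.

Lemma nonexpansive_continuous (T : {linear V -> W}) :
  nonexpansive T -> continuous T.
Proof.
move=> T1 x; apply/cvgrPdist_lt => e e0; near=> y.
rewrite -linearB; apply: le_lt_trans (T1 _) _.
by near: y; exact: (@cvgr_dist_lt _ _ _ _ _ idfun).
Unshelve. all: by end_near. Qed.

Lemma contraction_nonexpansive (T : {linear V -> W}) :
  contraction_operator T -> nonexpansive T.
Proof.
move=> T1 x; have [->|x0] := eqVneq x 0; first by rewrite linear0 !normr0.
have nx0 : 0 < `|x| by rewrite normr_gt0.
have : `|T (`|x|^-1 *: x)| <= 1.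
  have := ereal_sup_ubound (_ : [set (complex.Re `|T x|)%:E |
    x in [set x : V | `|x| <= 1]] (complex.Re `|T (`|x|^-1 *: x)|)%:E).
  move=> /(_ _)/le_trans/(_ T1); rewrite lee_fin -lecR RRe_real ?normr_real//.
  apply; exists (`|x|^-1 *: x) => //=.
  by rewrite normrZ normfV normr_id mulVf// gt_eqF.
by rewrite linearZ/= normrZ normfV normr_id ler_pdivrMl// mulr1.
Qed.

End LinearMaps.

Section Riesz.
Variables (R : realType) (V : hilbertType R).
Local Notation C := R[i].

(** The kernel of a nonzero functional [f] is closed, so it has a nonzero
    orthogonal vector [q]; since [f q x - f x q] is always in the kernel, [f] is
    proportional to the inner product with [q]. *)
Lemma riesz_representation (f : V -> C) (k : C) : 0 <= k ->
  (forall a x y, f (a *: x + y) = a * f x + f y) ->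
  (forall x, `|f x| <= k * `|x|) ->
  exists z, forall x, f x = '<| x, z |>.
Proof.
move=> k0 flin fk.
have f0 : f 0 = 0 by have := fk 0; rewrite normr0 mulr0 normr_le0 => /eqP.
have fB x y : f (x - y) = f x - f y.
  by rewrite addrC -scaleN1r flin mulN1r addrC.
pose N := [set x | f x = 0].
have Nlin a x y : N x -> N y -> N (a *: x + y).
  by rewrite /N/= flin => -> ->; rewrite mulr0 addr0.
have [f00|/existsNP[x0 fx0]] := EM (forall x, f x = 0).
  by exists 0 => x; rewrite hdot0r f00.
have [p Np px0] := orthogonal_projection (f0 : N 0) Nlin x0.
have fp : f p = 0.
  by apply: (closure_ker k0 _ _ Np) => // y z; rewrite -fB.
pose q := x0 - p; have fq : f q = f x0 by rewrite /q fB fp subr0.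
have q0 : '<| q, q |> != 0.
  apply: contra_notN fx0 => /eqP/hdot_eq0 q0.
  by rewrite -fq q0 f0.
exists (Num.conj (f q / '<| q, q |>) *: q) => x.
rewrite hdotZr conjCK mulrAC; apply: canRL (mulfK q0) _.
have : N (f q *: x - f x *: q).
  by rewrite /N/= fB -[_ *: x]addr0 -[_ *: q]addr0 !flin f0 !addr0 mulrC subrr.
by move/px0/hdot_eq0C/eqP; rewrite hdotBl !hdotZl subr_eq0 => /eqP <-.
Qed.

End Riesz.

Section Adjoint.
Variables (R : realType) (V W : hilbertType R) (T : {linear V -> W}).
Hypothesis T1 : nonexpansive T.

Lemma adjointP x y : '<| T x, y |> = '<| x, adjoint T y |>.
Proof.
suff : exists z, forall x, '<| T x, y |> = '<| x, z |>.
  by move=> ex; move: x; exact: (getPex ex).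
apply: (@riesz_representation _ _ _ `|y|) => // [a u v|u].
  by rewrite linearP hdotDl hdotZl.
by apply: le_trans (cauchy_schwarz _ _) _; rewrite mulrC ler_wpM2l.
Qed.

Lemma adjointPr x y : '<| y, T x |> = '<| adjoint T y, x |>.
Proof. by rewrite hdotC adjointP -hdotC. Qed.

Lemma adjoint_linear : linear (adjoint T).
Proof.
move=> a x y; apply: hdot_injr => z.
by rewrite -adjointP !(hdotDr, hdotZr) -!adjointP.
Qed.

Lemma adjoint_nonexpansive : nonexpansive (adjoint T).
Proof.
move=> y; have [->|y0] := eqVneq (adjoint T y) 0; first by rewrite normr0.
rewrite -(ler_pM2l (_ : 0 < `|adjoint T y|)) ?normr_gt0// -expr2.
rewrite hdot_norm -adjointP.
have := hdot_ge0 (adjoint T y); rewrite -adjointP => /ger0_norm <-.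
by apply: le_trans (cauchy_schwarz _ _) _; rewrite ler_wpM2r.
Qed.

End Adjoint.

Section PositiveOperators.
Variables (R : realType) (V : hilbertType R).
Local Notation C := R[i].

Definition selfadjoint (T : V -> V) :=
  forall x y, '<| T x, y |> = '<| x, T y |>.

Lemma selfadjoint_form_real (T : V -> V) x : selfadjoint T ->
  '<| T x, x |> \is Num.real.
Proof. by move=> Tsa; apply/CrealP; rewrite -hdotC Tsa. Qed.

(** Polarisation: the sesquilinear form [<T x, y> - <x, T y>] vanishes on the
    diagonal, hence everywhere, because the scalars are complex. *)
Lemma positive_selfadjoint (T : V -> V) : positive_operator T -> selfadjoint T.
Proof.
move=> [Tlin _ T0]; have [T' TT'] := linear_fun_ex Tlin.
rewrite {}TT' in T0 *.
pose B x y := '<| T' x, y |> - '<| x, T' y |>.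
have Bxx x : B x x = 0.
  by apply/eqP; rewrite subr_eq0 [eqbRHS]hdotC geC0_conj.
have BDl x y z : B (x + y) z = B x z + B y z.
  by rewrite /B (linearD T') !hdotDl opprD addrACA.
have BDr x y z : B z (x + y) = B z x + B z y.
  by rewrite /B (linearD T') !hdotDr opprD addrACA.
have BZl a x y : B (a *: x) y = a * B x y.
  by rewrite /B (linearZ_LR T')/= !hdotZl mulrBr.
have BZr a x y : B x (a *: y) = Num.conj a * B x y.
  by rewrite /B (linearZ_LR T')/= !hdotZr mulrBr.
have BC x y : B x y + B y x = 0.
  by have := Bxx (x + y); rewrite BDl !BDr !Bxx addr0 add0r.
move=> x y; apply/eqP; rewrite -subr_eq0 -[_ - _]/(B x y).
have := BC x ('i *: y); rewrite BZl BZr conjCi mulNr addrC -mulrBr => /eqP.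
rewrite mulf_eq0 (negPf (neq0Ci _)) /= subr_eq0 => /eqP ByxE.
by have /eqP := BC x y; rewrite ByxE -mulr2n mulrn_eq0.
Qed.

(** The difference [w = S x - c x] satisfies [S w = - c w], which contradicts
    positivity unless [w] or [c] is zero. *)
Lemma positive_sqrt_eigen (S : V -> V) (c : C) x : positive_operator S ->
  0 <= c -> S (S x) = c ^+ 2 *: x -> S x = c *: x.
Proof.
move=> S_pos c0; have Ssa := positive_selfadjoint S_pos.
case: S_pos => Slin _ S0; have [S' SS'] := linear_fun_ex Slin.
rewrite {}SS' in Ssa S0 * => SSx.
have [cE|c_neq0] := eqVneq c 0.
  by rewrite cE scale0r; apply: hdot_eq0; rewrite Ssa SSx cE expr0n scale0r hdot0r.
pose w := S' x - c *: x.
have Sw : S' w = - c *: w.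
  by rewrite /w linearB linearZ/= SSx scalerBr scalerA mulNr -expr2 !scaleNr opprK addrC.
have := S0 w; rewrite Sw hdotZl mulNr oppr_ge0 pmulr_rle0 ?lt_def ?c_neq0//.
move=> w0; apply/eqP; rewrite -subr_eq0 -/w; apply/eqP/hdot_eq0/eqP.
by rewrite eq_le w0 hdot_ge0.
Qed.

End PositiveOperators.

(** * Positive square roots *)

Section SquareRoot.
Variables (R : realType) (V : hilbertType R) (K : {linear V -> V}).
Local Notation C := R[i].
Hypotheses (K1 : nonexpansive K) (Ksa : selfadjoint K).

(** Picard iterates for [Y = (K + Y^2) / 2], the equation satisfied by
    [Y = 1 - (1 - K)^(1/2)]. *)
Fixpoint sqrt_iter (n : nat) : V -> V :=
  if n is n'.+1 then
    fun x => 2^-1 *: (K x + sqrt_iter n' (sqrt_iter n' x))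
  else fun=> 0.

(** The same iterates for the number [1], the bound on the norm of [K]. *)
Fixpoint sqrt_iter_bound (n : nat) : R :=
  if n is n'.+1 then (1 + sqrt_iter_bound n' ^+ 2) / 2 else 0.

Local Notation Y := sqrt_iter.
Local Notation b := sqrt_iter_bound.

Let b_itv n : 0 <= b n <= 1.
Proof. by elim: n => [|n /andP[b0 b1]] /=; [rewrite lexx ler01|nra]. Qed.

Let b_ge0 n : 0 <= b n. Proof. by case/andP: (b_itv n). Qed.

Let b_le1 n : b n <= 1. Proof. by case/andP: (b_itv n). Qed.

Let bS n : b n <= b n.+1.
Proof.
elim: n => [|n bnS]; first exact: b_ge0 1%N.
by have := b_ge0 n; move: bnS => /=; nra.
Qed.

Let half_ge0 : 0 <= 2^-1 :> C. Proof. by rewrite invr_ge0 ler0n. Qed.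

Let halfE : 2^-1%:C = 2^-1 :> C. Proof. by rewrite fmorphV/= rmorph_nat. Qed.

Let realcD (p q : R) : (p + q)%:C = p%:C + q%:C. Proof. exact: rmorphD. Qed.

Let realcM (p q : R) : (p * q)%:C = p%:C * q%:C. Proof. exact: rmorphM. Qed.

Let iter_linear n : linear (Y n).
Proof.
elim: n => [|n IHn] a x y /=; first by rewrite scaler0 addr0.
by rewrite linearP !IHn addrACA -(scalerDr a) [LHS]scalerDr !scalerA mulrC.
Qed.

Let iterB n x y : Y n (x - y) = Y n x - Y n y.
Proof.
by have [Y' ->] := linear_fun_ex (iter_linear n); rewrite linearB.
Qed.

Let iter_sa n : selfadjoint (Y n).
Proof.
elim: n => [|n IHn] x y /=; first by rewrite hdot0l hdot0r.
by rewrite hdotZl hdotZr hdotDl hdotDr Ksa !IHn -halfE conj_Creal// complex_real.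
Qed.

Let iter_norm n x : `|Y n x| <= (b n)%:C * `|x|.
Proof.
elim: n x => [|n IHn] x /=; first by rewrite normr0 mul0r.
rewrite normrZ ger0_norm// realcM halfE mulrAC mulrC ler_wpM2r//.
rewrite realcD expr2 realcM mulrDl mul1r.
apply: le_trans (ler_normD _ _) (lerD (K1 _) _).
by apply: le_trans (IHn _) _; rewrite -mulrA ler_wpM2l// lecR.
Qed.

(** The scalar iterates dominate the operator iterates, increments included,
    because the recursion has nonnegative coefficients; as the former converge,
    the latter are Cauchy. *)
Let iter_incr n x : `|Y n.+1 x - Y n x| <= (b n.+1 - b n)%:C * `|x|.
Proof.
elim: n x => [|n IHn] x.
  by rewrite /= !subr0; exact: (iter_norm 1).
rewrite [Y n.+2 x]/= [in X in _ - X]/= -scalerBr opprD addrACA subrr add0r.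
have -> : Y n.+1 (Y n.+1 x) - Y n (Y n x) =
    Y n.+1 (Y n.+1 x - Y n x) + (Y n.+1 (Y n x) - Y n (Y n x)).
  by rewrite iterB subrKA.
rewrite normrZ ger0_norm//.
have -> : b n.+2 - b n.+1 = 2^-1 * (b n.+1 * (b n.+1 - b n) + (b n.+1 - b n) * b n).
  rewrite -[b n.+2]/((1 + b n.+1 ^+ 2) / 2).
  by rewrite -[X in _ - X = _]/((1 + b n ^+ 2) / 2); field.
rewrite realcM halfE -mulrA ler_wpM2l// realcD mulrDl.
rewrite (realcM (b n.+1)) (realcM _ (b n)) -!mulrA.
apply: le_trans (ler_normD _ _) (lerD _ _).
  by apply: le_trans (iter_norm _ _) _; rewrite ler_wpM2l// lecR.
by apply: le_trans (IHn _) _; rewrite ler_wpM2l ?iter_norm// lecR subr_ge0.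
Qed.

Let iter_dist m n x : (n <= m)%N -> `|Y m x - Y n x| <= (b m - b n)%:C * `|x|.
Proof.
move=> /subnK <-; elim: (m - n)%N => [|k IHk].
  by rewrite !subrr normr0 mul0r.
rewrite addSn -(subrKA (Y (k + n) x)) -(subrKA (b (k + n))) realcD mulrDl.
exact: le_trans (ler_normD _ _) (lerD (iter_incr _ _) IHk).
Qed.

Let iter_cvg x : cvgn (fun n => Y n x).
Proof.
apply: cauchy_seq_cvg => e e0; pose r := complex.Re (e / (`|x| + 1)).
have x1 : 0 < `|x| + 1 by rewrite ltr_wpDl.
have rE : r%:C = e / (`|x| + 1) by rewrite RRe_gt0// divr_gt0.
have r0 : 0 < r by rewrite -ltcR rE divr_gt0.
have b_sup : has_sup (range b).
  by split; [exists 0, 0%N|exists 1 => _ [n _ <-]].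
have [_ [N _ <-] bN] := sup_adherent r0 b_sup.
have b_mono : {homo b : m n / (m <= n)%N >-> m <= n}.
  by apply: homo_leq => //; exact: le_trans.
exists N => m n; wlog nm : m n / (n <= m)%N => [wlg|] Nm Nn.
  by have [/wlg->//|/ltnW/wlg] := leqP n m; rewrite distrC; apply.
apply: le_lt_trans (iter_dist _ nm) _.
have bmn : b m - b n <= r.
  have bm : b m <= sup (range b) by apply: sup_ubound; [case: b_sup|exists m].
  by have := b_mono _ _ Nn; lra.
apply: (@le_lt_trans _ _ (r%:C * `|x|)); first by rewrite ler_wpM2r// lecR.
by rewrite rE mulrAC ltr_pdivrMr// ltr_pM2l// ltrDl.
Qed.

Let Ylim x : V := lim (Y n x @[n --> \oo]).

Let YlimP x : Y n x @[n --> \oo] --> Ylim x.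
Proof. exact: iter_cvg. Qed.

Let Ylim_linear : linear Ylim.
Proof.
move=> a x y; apply: cvg_lim => //.
under eq_fun do rewrite iter_linear.
apply: cvgD; last exact: YlimP.
by apply: cvgZr; exact: YlimP.
Qed.

Let Ylim_nonexpansive : nonexpansive Ylim.
Proof.
move=> x; apply/ler_addgt0Pr => e e0.
move/cvgrPdist_lt/(_ e e0) : (@YlimP x) => [n _ /(_ n (leqnn n))/ltW Yn].
rewrite -[Ylim x](subrK (Y n x)); apply: le_trans (ler_normD _ _) _.
rewrite [leRHS]addrC lerD// ?Yn//; apply: le_trans (iter_norm n x) _.
by rewrite ler_piMl// lecR.
Qed.

Let Ylim_sa : selfadjoint Ylim.
Proof.
move=> x y; have xy := cvg_lipschitz (hdot_lipschitz y) (@YlimP x).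
have yx := cvg_lipschitz (hdot_lipschitzr x) (@YlimP y).
rewrite (_ : _ \o _ = (fun z => '<| x, z |>) \o (fun n => Y n y)) in xy.
  exact: cvg_unique xy yx.
by apply/funext => n /=; rewrite iter_sa.
Qed.

Let Ylim_fixpoint x : Ylim x = 2^-1 *: (K x + Ylim (Ylim x)).
Proof.
have YY : Y n (Y n x) @[n --> \oo] --> Ylim (Ylim x).
  under eq_fun => n do rewrite -[Y n (Y n x)](subrK (Y n (Ylim x))) -iterB.
  suff : Y n (Y n x - Ylim x) @[n --> \oo] --> 0.
    by move=> /cvgD/(_ (@YlimP (Ylim x))); rewrite add0r.
  apply/cvgrPdist_lt => e e0; near=> n; rewrite sub0r normrN.
  apply: le_lt_trans (iter_norm _ _) _.
  apply: (@le_lt_trans _ _ `|Y n x - Ylim x|); first by rewrite ler_piMl// lecR.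
  rewrite distrC; near: n; exact: (cvgrPdist_lt _ _).1 (@YlimP x) e e0.
apply: cvg_lim => //; rewrite -cvg_shiftS /=.
by apply: cvgZr; apply: cvgD YY; exact: cvg_cst.
Unshelve. all: by end_near. Qed.

(** If [Y] solves [2 Y = K + Y^2], then [(1 - Y)^2 = 1 - K]; and [1 - Y] is
    positive because [Y] is self-adjoint with norm at most [1]. *)
Lemma positive_sqrt_ex :
  exists S, positive_operator S /\ S \o S = idfun \- K.
Proof.
have [Z YZ] := linear_fun_ex Ylim_linear.
have Zsa := Ylim_sa; have Z1 := Ylim_nonexpansive; have ZE := Ylim_fixpoint.
rewrite {}YZ in Zsa Z1 ZE.
exists (idfun \- Z); split; last first.
  apply/funext => x /=; rewrite linearB.
  have {1}-> : K x = 2 *: Z x - Z (Z x).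
    by rewrite [X in 2 *: X]ZE scalerA mulfV ?pnatr_eq0// scale1r addrK.
  by rewrite scaler_nat mulr2n !opprD opprK !addrA.
split=> [||x].
- by move=> a x y /=; rewrite linearP scalerBr opprD addrACA.
- by move=> x; apply: cvgB; [exact: cvg_id|exact: nonexpansive_continuous].
- rewrite hdotBl subr_ge0; apply: le_trans (real_ler_norm _) _.
    exact: selfadjoint_form_real.
  by apply: le_trans (cauchy_schwarz _ _) _; rewrite -hdot_norm expr2 ler_wpM2r.
Qed.

End SquareRoot.

(** * Orthonormal bases and eigenvectors *)

Section Bases.
Variables (R : realType) (V : hilbertType R).
Local Notation C := R[i].
Implicit Types (x y z : V) (E : set V).

Lemma lspan0 E : lspan E 0.
Proof.
exists 0%N, (fun=> 0), (fun=> 0); split; first by case.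
by rewrite big_ord0.
Qed.

Lemma sub_lspan E : E `<=` lspan E.
Proof.
move=> x Ex; exists 1%N, (fun=> 1), (fun=> x); split=> //.
by rewrite big_ord1 scale1r.
Qed.

Lemma lspan_linear E a x y : lspan E x -> lspan E y -> lspan E (a *: x + y).
Proof.
move=> [m [c [e [eE ->]]]] [n [d [f [fE ->]]]].
exists (m + n)%N, (fun i => match fintype.split i with inl j => a * c j | inr k => d k end),
  (fun i => match fintype.split i with inl j => e j | inr k => f k end); split.
  by move=> i; case: fintype.split.
rewrite big_split_ord scaler_sumr; congr (_ + _); apply: eq_bigr => i _.
  by rewrite (unsplitK (inl i)) scalerA.
by rewrite (unsplitK (inr i)).
Qed.

Lemma lspan_orth E x y :
  (forall e, E e -> '<| e, y |> = 0) -> lspan E x -> '<| x, y |> = 0.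
Proof.
move=> Ey [n [c [e [eE ->]]]]; rewrite hdot_suml big1// => i _.
by rewrite hdotZl Ey// mulr0.
Qed.

Lemma dense_closure (S : set V) x : dense S -> closure S x.
Proof.
move=> dS B; rewrite nbhsE => -[O [oO Ox] OB].
by have [y [Oy Sy]] := dS O (ex_intro _ x Ox) oO; exists y; split=> //; exact: OB.
Qed.

(** In a complete space, a set is total as soon as only the zero vector is
    orthogonal to it: the foot of the perpendicular from [x] to its span
    cannot differ from [x]. *)
Lemma dense_lspanP E :
  dense (lspan E) <->
  (forall x, (forall e, E e -> '<| x, e |> = 0) -> x = 0).
Proof.
split=> [dE x xE|E0].
  apply/hdot_eq0; apply: (closure_orth _ (dense_closure (x := x) dE)) => m.
  by apply: lspan_orth => e /xE/hdot_eq0C.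
move=> O [x Ox] oO.
have [p Ep pE] := orthogonal_projection (lspan0 E) (@lspan_linear E) x.
have xp : x - p = 0 by apply: E0 => e /sub_lspan; exact: pE.
have {xp}xp : x = p by apply/eqP; rewrite -subr_eq0 xp.
have [y [Ey Oy]] : (lspan E `&` O) !=set0.
  by apply: Ep; rewrite -xp; exact: open_nbhs_nbhs.
by exists y.
Qed.

Definition joint_eigenvector (T S : V -> V) : set V :=
  eigenvector T `&` eigenvector S.

Lemma eigenvector_scale (T : {linear V -> V}) (a : C) x :
  a != 0 -> eigenvector T x -> eigenvector T (a *: x).
Proof.
move=> a0 [x0 [b Tx]]; split; first by rewrite scaler_eq0 negb_or a0.
by exists b; rewrite linearZ/= Tx !scalerA mulrC.
Qed.

(** The orthogonal complement of a set of eigenvectors of [T] and of its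
    adjoint [S] is invariant under both, so projecting onto it maps an
    eigenvector of [T] to an eigenvector or to zero. *)
Lemma eigenvector_orth_component (T S : {linear V -> V}) E (x q : V) (a : C) :
  (forall y z, '<| T y, z |> = '<| y, S z |>) ->
  E `<=` joint_eigenvector T S -> T x = a *: x ->
  (forall e, E e -> '<| q, e |> = 0) ->
  (forall z, (forall e, E e -> '<| z, e |> = 0) -> '<| x - q, z |> = 0) ->
  T q = a *: q.
Proof.
move=> TS EX Tx qE xqE.
have STC y z : '<| S y, z |> = '<| y, T z |> by rewrite hdotC -TS -hdotC.
have TE z : (forall e, E e -> '<| z, e |> = 0) ->
    forall e, E e -> '<| T z, e |> = 0.
  by move=> zE e Ee; have [_ [_ [b Se]]] := EX e Ee; rewrite TS Se hdotZr zE// mulr0.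
have SE z : (forall e, E e -> '<| z, e |> = 0) ->
    forall e, E e -> '<| S z, e |> = 0.
  by move=> zE e Ee; have [[_ [b Te]] _] := EX e Ee; rewrite STC Te hdotZr zE// mulr0.
pose w := T q - a *: q.
have wE e : E e -> '<| w, e |> = 0.
  by move=> Ee; rewrite hdotBl hdotZl qE// TE// mulr0 subrr.
apply/eqP; rewrite -subr_eq0 -/w; apply/eqP/hdot_eq0.
have {1}-> : w = - (T (x - q) - a *: (x - q)).
  rewrite (linearB T) Tx scalerBr.
  by rewrite opprB opprB [RHS]addrC subrKA.
by rewrite hdotNl hdotBl hdotZl TS !xqE ?mulr0 ?subrr ?oppr0//; exact: SE.
Qed.

(** A maximal orthonormal set of joint eigenvectors is a basis: otherwise some
    joint eigenvector has a nonzero component orthogonal to the set, and that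
    component, once normalised, could be added to it. *)
Lemma orthonormal_eigenbasis (T S : {linear V -> V}) :
  (forall y z, '<| T y, z |> = '<| y, S z |>) ->
  (forall z, (forall x, joint_eigenvector T S x -> '<| z, x |> = 0) -> z = 0) ->
  exists2 E, orthonormal_basis E & E `<=` joint_eigenvector T S.
Proof.
move=> TS total; pose X := joint_eigenvector T S.
pose P := [set E : set V | orthonormal_family E id /\ E `<=` X].
have [F FP F_chain|E [[E_on EX] E_max]] := @Zorn_bigcup V P.
  split=> [x y [A FA Ax] [B FB By]|x [A /FP[_ AX] /AX]//].
  have [AB|BA] := F_chain A B FA FB.
    by have [+ _] := FP B FB; apply=> //; exact: AB.
  by have [+ _] := FP A FA; apply=> //; exact: BA.
exists E => //; split=> //; apply/dense_lspanP => z zE.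
apply: total => x Xx; apply/eqP; apply: contrapT => /negP zx.
pose N := [set y | forall e, E e -> '<| y, e |> = 0].
have N0 : N 0 by move=> e _; rewrite hdot0l.
have N_lin a u v : N u -> N v -> N (a *: u + v).
  by move=> Nu Nv e Ee; rewrite hdotDl hdotZl Nu// Nv// mulr0 addr0.
have [q cNq xqN] := orthogonal_projection N0 N_lin x.
have Nq : N q by move=> e Ee; apply: (closure_orth _ cNq) => m /(_ e Ee).
have q0 : q != 0.
  apply: contra_neq zx => q0; apply: hdot_eq0C.
  by have := xqN z zE; rewrite q0 subr0.
have Xq : X q.
  have [[_ [a Tx]] [_ [b Sx]]] := Xx; split; split=> //.
    by exists a; exact: (eigenvector_orth_component TS EX Tx Nq).
  exists b; apply: (@eigenvector_orth_component S T E x) => //.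
    by move=> u v; rewrite hdotC -TS -hdotC.
  by rewrite /joint_eigenvector setIC.
have qn0 : `|q| != 0 by rewrite normr_eq0.
pose n := `|q|^-1 *: q.
have Nn : N n by move=> e Ee; rewrite hdotZl Nq// mulr0.
have nn : '<| n, n |> = 1.
  by rewrite -hdot_norm normrZ normfV normr_id mulVf// expr1n.
have En : ~ E n.
  by move=> /Nn; rewrite nn => /eqP; rewrite oner_eq0.
have Xn : X n by split; apply: eigenvector_scale; rewrite ?invr_eq0//; case: Xq.
apply: (E_max (n |` E)).
  by split=> [|/(_ n (or_introl erefl))]//; exact: subsetUr.
split=> [x' y'|y [->|/EX]//].
have E_neq e : E e -> n == e = false.
  by move=> Ee; apply/negbTE/eqP => ne; rewrite -ne in Ee.
move=> [->|Ex'] [->|Ey'] /=; last exact: E_on.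
- by rewrite nn eqxx.
- by rewrite Nn// E_neq.
- by rewrite (hdot_eq0C (Nn _ _))// eq_sym E_neq.
Qed.

Lemma orthonormal_dist E x y : orthonormal_family E id -> E x -> E y ->
  x != y -> `|x - y| ^+ 2 = 2.
Proof.
move=> E_on Ex Ey xy; rewrite hdot_norm hdotBl !hdotBr.
rewrite !E_on// !eqxx (negbTE xy) eq_sym (negbTE xy) /=.
by rewrite subr0 sub0r opprK.
Qed.

(** Distinct unit orthogonal vectors are at distance [sqrt 2 > 1], so
    approximating each within [1/2] by a dense sequence is injective. *)
Lemma orthonormal_countable E : separable_space V ->
  orthonormal_family E id -> countable E.
Proof.
move=> [D /countable_injP[f f_inj] dD] E_on.
have half0 : 0 < 2^-1 :> C by rewrite invr_gt0 ltr0n.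
have /choice[d dP] : forall x, exists y, D y /\ `|x - y| < 2^-1.
  move=> x; have [y Dy xy] := closure_dist (dense_closure (x := x) dD) half0.
  by exists y.
apply/countable_injP; exists (f \o d) => x y; rewrite !inE => Ex Ey /= fxy.
have dxy : d x = d y by apply: f_inj; rewrite ?inE//; exact: (dP _).1.
apply/eqP; apply: contrapT => /negP xy.
have : `|x - y| < 1.
  rewrite -(subrKA (d x)); apply: le_lt_trans (ler_normD _ _) _.
  by rewrite [ltRHS]splitr mul1r ltrD// ?(dP _).2// dxy distrC (dP _).2.
rewrite -(@ltr_sqr _ _ 1) ?nnegrE// expr1n (orthonormal_dist E_on)//.
by rewrite ltrn1.
Qed.

(** The partial sum [P N] is at least as close to [h] as any combination of
    [e 0], ..., [e (N - 1)], and such combinations come arbitrarily close to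
    [h].  Zero terms are allowed so that a countable basis can be enumerated
    with gaps. *)
Lemma fourier_series (e : nat -> V) h :
  (forall m n, m != n -> '<| e m, e n |> = 0) ->
  (forall n, e n != 0 -> '<| e n, e n |> = 1) ->
  dense (lspan (range e)) ->
  (\sum_(0 <= n < N) '<| h, e n |> *: e n) @[N --> \oo] --> h.
Proof.
move=> e_orth e_unit e_dense.
pose P N := \sum_(0 <= n < N) '<| h, e n |> *: e n.
have hP N m : (m < N)%N -> '<| e m, h - P N |> = 0.
  move=> mN; apply: hdot_eq0C; rewrite hdotBl hdot_suml big_mkord.
  rewrite (bigD1 (Ordinal mN))//= big1 => [|i im]; last first.
    by rewrite hdotZl e_orth ?mulr0.
  rewrite addr0 hdotZl; have [->|/e_unit->] := eqVneq (e m) 0.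
    by rewrite !hdot0r mul0r subrr.
  by rewrite mulr1 subrr.
apply/cvgrPdist_lt => r r0.
have [v [k [c [w [we vE]]]] hv] := closure_dist (dense_closure (x := h) e_dense) r0.
have /choice[nu nuP] : forall i, exists n, w i = e n.
  by move=> i; have [n _ <-] := we i; exists n.
exists (\max_i (nu i).+1)%N => // N /= maxN; apply: le_lt_trans hv.
have vP : '<| h - P N, P N - v |> = 0.
  apply: hdot_eq0C; rewrite hdotBl vE !hdot_suml big_mkord !big1 ?subrr// => i _.
    rewrite hdotZl nuP hP ?mulr0//; apply: leq_trans maxN.
    exact: (leq_bigmax (F := fun i => (nu i).+1) i).
  by rewrite hdotZl hP ?mulr0.
rewrite -ler_sqr ?nnegrE// -[X in _ <= `|X| ^+ 2](subrKA (P N)).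
by rewrite (pythagoras vP) lerDl exprn_ge0.
Qed.

End Bases.

(** * The flipped Julia operator *)

Section FlippedJulia.
Variables (R : realType) (V : hilbertType R) (A : {linear V -> V}).
Local Notation C := R[i].
Hypothesis A1 : nonexpansive A.

Local Notation Aadj := (adjoint A).
Local Notation D := (opsqrt (idfun \- (Aadj \o A))).
Local Notation D' := (opsqrt (idfun \- (A \o Aadj))).
Local Notation U := (flip_operator V \o julia_operator A).

Lemma opsqrt_idB (K : V -> V) : linear K -> nonexpansive K -> selfadjoint K ->
  positive_operator (opsqrt (idfun \- K)) /\
  opsqrt (idfun \- K) \o opsqrt (idfun \- K) = idfun \- K.
Proof.
move=> /linear_fun_ex[K' ->] K1 Ksa.
exact: (getPex (positive_sqrt_ex K1 Ksa)).
Qed.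

Lemma opsqrt_idB_eigen (K : V -> V) (c : C) x :
  linear K -> nonexpansive K -> selfadjoint K ->
  0 <= c -> K x = (1 - c ^+ 2) *: x -> opsqrt (idfun \- K) x = c *: x.
Proof.
move=> Klin K1 Ksa c0 Kx; have [S_pos SS] := opsqrt_idB Klin K1 Ksa.
apply: positive_sqrt_eigen => //; rewrite -[LHS]/((_ \o _) x) SS /= Kx.
by rewrite scalerBl scale1r opprB addrC subrK.
Qed.

Let AadjA_linear : linear (Aadj \o A).
Proof. by move=> a x y /=; rewrite linearP adjoint_linear. Qed.

Let AAadj_linear : linear (A \o Aadj).
Proof. by move=> a x y /=; rewrite adjoint_linear// linearP. Qed.

Let AadjA_nonexpansive : nonexpansive (Aadj \o A).
Proof. by move=> x; apply: le_trans (adjoint_nonexpansive _ _) _. Qed.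

Let AAadj_nonexpansive : nonexpansive (A \o Aadj).
Proof. by move=> x; apply: le_trans (A1 _) _; exact: adjoint_nonexpansive. Qed.

Lemma AadjA_selfadjoint : selfadjoint (Aadj \o A).
Proof. by move=> x y /=; rewrite -adjointPr// -adjointP. Qed.

Let AAadj_selfadjoint : selfadjoint (A \o Aadj).
Proof. by move=> x y /=; rewrite adjointP// adjointPr. Qed.

Let DD x : D (D x) = x - Aadj (A x).
Proof.
have [_ /(congr1 (fun f => f x))] :=
  opsqrt_idB AadjA_linear AadjA_nonexpansive AadjA_selfadjoint.
by [].
Qed.

Let D_pos : positive_operator D.
Proof. by have [] := opsqrt_idB AadjA_linear AadjA_nonexpansive AadjA_selfadjoint. Qed.

Let D'_pos : positive_operator D'.
Proof. by have [] := opsqrt_idB AAadj_linear AAadj_nonexpansive AAadj_selfadjoint. Qed.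

Lemma flip_juliaE z : U z = (D z.1 - Aadj z.2, A z.1 + D' z.2).
Proof. by rewrite /= /flip_operator /block_operator /= add0r addr0. Qed.

(** The adjoint of [U]; see [flip_julia_adjP]. *)
Let Uadj (z : hsum V V) : hsum V V := (D z.1 + Aadj z.2, D' z.2 - A z.1).

Lemma flip_julia_linear : linear U.
Proof.
have [D_lin _ _] := D_pos; have [D'_lin _ _] := D'_pos.
move=> a x y; rewrite !flip_juliaE.
apply: (congr2 pair) => /=.
  by rewrite D_lin adjoint_linear// opprD addrACA scalerBr.
by rewrite linearP D'_lin addrACA scalerDr.
Qed.

Lemma flip_julia_adj_linear : linear Uadj.
Proof.
have [D_lin _ _] := D_pos; have [D'_lin _ _] := D'_pos.
move=> a x y; apply: (congr2 pair) => /=.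
  by rewrite D_lin adjoint_linear// addrACA scalerDr.
by rewrite linearP D'_lin opprD addrACA scalerBr.
Qed.

Lemma flip_julia_adjP y z : '<| U y, z |> = '<| y, Uadj z |>.
Proof.
have Dsa := positive_selfadjoint D_pos; have D'sa := positive_selfadjoint D'_pos.
rewrite flip_juliaE -[LHS]/('<| _, z.1 |> + '<| _, z.2 |>) /=.
rewrite -[RHS]/('<| y.1, _ |> + '<| y.2, _ |>) /=.
rewrite !(hdotDl, hdotDr, hdotNl, hdotNr) Dsa D'sa adjointP//.
by rewrite (adjointPr A1 z.1); ring.
Qed.

(** On the span of [(g, 0)] and [(0, f)], the operator [U] acts as a rotation
    of angle [arcsin s], with eigenvectors [(g, w f)] for the two square roots
    [w] of [-1]; the adjoint rotates by the opposite angle. *)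
Lemma singular_pair_eigenvector (s : R) (f g : V) (w : C) :
  w ^+ 2 = -1 -> (g != 0) || (f != 0) -> 0 <= s <= 1 ->
  A g = s%:C *: f -> Aadj f = s%:C *: g ->
  joint_eigenvector U Uadj ((g, w *: f) : hsum V V).
Proof.
move=> w2 gf0 /andP[s0 s1] Ag Af.
pose c : R := Num.sqrt (1 - s ^+ 2).
have c0 : 0 <= c%:C :> C by rewrite lecR sqrtr_ge0.
have cs : s%:C ^+ 2 = 1 - c%:C ^+ 2 :> C.
  rewrite -!(rmorphXn (real_complex R)) sqr_sqrtr; last by nra.
  by rewrite rmorphB rmorph1 opprB addrC subrK.
have [adj_lin D_lin D'_lin] :
    [/\ linear Aadj, linear D & linear D'].
  by split; [exact: adjoint_linear|case: D_pos|case: D'_pos].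
have Dg : D g = c%:C *: g.
  apply: (opsqrt_idB_eigen AadjA_linear _ AadjA_selfadjoint) => //=.
  rewrite Ag -cs.
  have [B BE] := linear_fun_ex adj_lin; rewrite {}BE in Af *.
  by rewrite linearZ/= Af scalerA.
have D'f : D' f = c%:C *: f.
  apply: (opsqrt_idB_eigen AAadj_linear _ AAadj_selfadjoint) => //=.
  by rewrite Af (linearZ_LR A)/= Ag scalerA -cs.
have Aadjw : Aadj (w *: f) = (w * s%:C) *: g.
  have [B BE] := linear_fun_ex adj_lin; rewrite {}BE in Af *.
  by rewrite linearZ/= Af scalerA.
have D'w : D' (w *: f) = (w * c%:C) *: f.
  have [B BE] := linear_fun_ex D'_lin; rewrite {}BE in D'f *.
  by rewrite linearZ/= D'f scalerA.
have {}gf0 : ((g, w *: f) : hsum V V) != 0.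
  apply/eqP => -[g0 /eqP]; rewrite scaler_eq0 => /orP[/eqP w0|/eqP f0].
    by move/eqP: w2; rewrite w0 expr0n eq_sym oppr_eq0 oner_eq0.
  by rewrite g0 f0 eqxx in gf0.
split; split=> //.
  exists (c%:C - w * s%:C); rewrite flip_juliaE; apply: (congr2 pair) => /=.
    by rewrite Dg Aadjw scalerBl.
  rewrite Ag D'w scalerA -scalerDl mulrBl mulrAC -expr2 w2; congr (_ *: _); ring.
exists (c%:C + w * s%:C); apply: (congr2 pair) => /=.
  by rewrite Dg Aadjw scalerDl.
by rewrite Ag D'w scalerA -scalerBl mulrDl mulrAC -expr2 w2; congr (_ *: _); ring.
Qed.

(** A singular pair yields the two eigenvectors [(g, i f)] and [(g, - i f)],
    and [(a, b)] is orthogonal to both exactly when [a] is orthogonal to [g]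
    and [b] to [f].  Vectors annihilated by [A] or by its adjoint form singular
    pairs with [s = 0], the other vector being zero. *)
Lemma singular_pairs_diagonalizable :
  (forall a b : V,
    (forall (s : R) f g, 0 <= s <= 1 -> A g = s%:C *: f -> Aadj f = s%:C *: g ->
      '<| a, g |> = 0 /\ '<| b, f |> = 0) -> a = 0 /\ b = 0) ->
  diagonalizable_operator U.
Proof.
move=> total.
have [T UT] := linear_fun_ex flip_julia_linear.
have [S US] := linear_fun_ex flip_julia_adj_linear.
have TS := flip_julia_adjP; have pairs := singular_pair_eigenvector.
rewrite {}UT {}US in TS pairs *.
have [|E E_basis EX] := orthonormal_eigenbasis TS; last first.
  by exists E; split=> // e /EX[].
move=> [a b] abX; suff [-> ->] : a = 0 /\ b = 0 by [].
apply: total => s f g s01 Ag Af.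
have [gf0|] := boolP ((g != 0) || (f != 0)); last first.
  by rewrite negb_or !negbK => /andP[/eqP-> /eqP->]; rewrite !hdot0r.
have ortho w : w ^+ 2 = -1 -> '<| a, g |> + Num.conj w * '<| b, f |> = 0.
  move=> w2; have := abX _ (pairs s f g w w2 gf0 s01 Ag Af).
  by rewrite -[LHS]/('<| a, g |> + '<| b, w *: f |>) hdotZr.
have := ortho 'i (sqrCi _); have := ortho (- 'i) _; rewrite sqrrN => /(_ (sqrCi _)).
rewrite rmorphN /= conjCi opprK mulNr => plus minus.
have ag0 : '<| a, g |> = 0.
  have /eqP := congr2 +%R plus minus.
  by rewrite addrACA subrr !addr0 -mulr2n mulrn_eq0 => /eqP.
split=> //; move/eqP: plus; rewrite ag0 add0r mulf_eq0 (negbTE (neq0Ci _)).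
by move=> /eqP.
Qed.

(** An orthonormal basis of eigenvectors of [U] also diagonalises its adjoint,
    hence its real part, which is [D] on the first copy of the space; and
    [D^2 = 1 - Aadj A]. *)
Lemma eigenbasis_AadjA (E : set (hsum V V)) e :
  orthonormal_basis E -> E `<=` eigenvector U -> E e ->
  exists a : C, Aadj (A e.1) = a *: e.1.
Proof.
move=> [E_on /dense_lspanP E_tot] EU Ee.
have [_ [l Ue]] := EU e Ee.
have Uadj_e : Uadj e = Num.conj l *: e.
  apply/eqP; rewrite -subr_eq0; apply/eqP/E_tot => e' Ee'.
  have [_ [l' Ue']] := EU e' Ee'.
  rewrite hdotBl hdotZl hdotC -flip_julia_adjP Ue' hdotZl rmorphM /= -hdotC.
  have := E_on e e' Ee Ee' => /= ->.
  have [ee'|] := eqVneq e e'; last by rewrite !mulr0 subrr.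
  suff -> : l' = l by rewrite subrr.
  have e0 : e != 0 by have [] := EU e Ee.
  have /eqP : (l' - l) *: e = 0.
    by rewrite scalerBl -Ue [in l' *: _]ee' -Ue' ee' subrr.
  by rewrite scaler_eq0 (negbTE e0) orbF subr_eq0 => /eqP.
have /(congr1 fst)/= U1 : U e = l *: e by [].
have /(congr1 fst)/= Uadj1 : Uadj e = Num.conj l *: e by [].
rewrite add0r in U1.
pose r := (l + Num.conj l) / 2.
have De : D e.1 = r *: e.1.
  have := congr2 +%R U1 Uadj1; rewrite addrACA addNr addr0 -scalerDl -mulr2n.
  move/(congr1 (fun x => 2^-1 *: x)).
  rewrite -[D e.1 *+ 2]scaler_nat !scalerA mulVf ?pnatr_eq0//.
  by rewrite scale1r mulrC.
exists (1 - r ^+ 2); have [D_lin _ _] := D_pos.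
have := DD e.1; rewrite De.
have -> : D (r *: e.1) = r ^+ 2 *: e.1.
  have [B BE] := linear_fun_ex D_lin; rewrite {}BE in De *.
  by rewrite linearZ/= De scalerA.
by move=> r2e; rewrite scalerBl scale1r r2e subKr.
Qed.

End FlippedJulia.

(** * Schmidt decompositions *)

Section SchmidtDecomposition.
Variables (R : realType) (V : hilbertType R) (A : {linear V -> V}).
Local Notation C := R[i].
Hypothesis A1 : nonexpansive A.

Local Notation Aadj := (adjoint A).

(** The inner products of the Schmidt series with the [f n] show that [f n] and
    [g n] form a singular pair.  A vector orthogonal to every [g n] is killed by
    [A], and one orthogonal to every [f n] by the adjoint. *)
Lemma schmidt_diagonalizable : schmidt_decomposable A ->
  diagonalizable_operator (flip_operator V \o julia_operator A).
Proof.
move=> [D [s [f [g [f_on g_on s0 A_cvg]]]]].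
pose P h N := \sum_(0 <= n < N | n \in D) ((s n)%:C *: rank1 (f n) (g n) h).
have A_dot h y (a : C) :
    (exists N0, forall N, (N0 <= N)%N -> '<| P h N, y |> = a) -> '<| A h, y |> = a.
  move=> [N0 PN0]; have PA := cvg_lipschitz (hdot_lipschitz y) (A_cvg h).
  have Pa : (fun z => '<| z, y |>) \o P h @ \oo --> (a : C^o).
    by apply: cvg_near_cst; exists N0 => // N /PN0.
  exact: cvg_unique PA Pa.
have P_dot h y N :
    '<| P h N, y |> =
    \sum_(0 <= n < N | n \in D) (s n)%:C * ('<| h, g n |> * '<| f n, y |>).
  by rewrite hdot_suml; apply: eq_bigr => n _; rewrite !hdotZl.
have A_dot1 h y n (a : C) : D n ->
    (s n)%:C * ('<| h, g n |> * '<| f n, y |>) = a ->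
    (forall k, D k -> k != n -> '<| h, g k |> * '<| f k, y |> = 0) ->
    '<| A h, y |> = a.
  move=> Dn <- h0; apply: A_dot; exists n.+1 => N nN; rewrite P_dot.
  rewrite big_mkord (bigD1 (Ordinal nN)) ?inE//= big1 ?addr0// => k /andP[Dk kn].
  by rewrite h0 ?mulr0//; exact: set_mem.
have A_dot0 h y : (forall k, D k -> '<| h, g k |> * '<| f k, y |> = 0) ->
    '<| A h, y |> = 0.
  move=> h0; apply: A_dot; exists 0%N => N _; rewrite P_dot big1// => k Dk.
  by rewrite h0 ?mulr0//; exact: set_mem.
have Ag n : D n -> A (g n) = (s n)%:C *: f n.
  move=> Dn; apply: hdot_inj => y; rewrite hdotZl.
  apply: (A_dot1 _ _ n) => // [|k Dk kn]; first by rewrite g_on// eqxx mul1r.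
  by rewrite g_on// eq_sym (negbTE kn) mul0r.
have Af n : D n -> Aadj (f n) = (s n)%:C *: g n.
  move=> Dn; apply: hdot_injr => x; rewrite -adjointP// hdotZr.
  rewrite conj_Creal ?complex_real//.
  apply: (A_dot1 _ _ n) => // [|k Dk kn]; first by rewrite f_on// eqxx mulr1.
  by rewrite f_on// (negbTE kn) mulr0.
have s1 n : D n -> 0 <= s n <= 1.
  move=> Dn; rewrite ltW ?s0//= -lecR.
  have norm1 (u : nat -> V) : orthonormal_family D u -> `|u n| = 1.
    move=> u_on; apply/eqP; rewrite -(@pexpr_eq1 _ _ 2)//.
    by rewrite hdot_norm u_on// eqxx.
  have := A1 (g n); rewrite Ag// normrZ !norm1// mulr1.
  by rewrite ger0_norm ?lecR// ltW// s0.
have zero01 : 0 <= (0 : R) <= 1 by rewrite lexx ler01.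
have adj0 : Aadj 0 = 0.
  by have [B ->] := linear_fun_ex (adjoint_linear A1); rewrite linear0.
apply: singular_pairs_diagonalizable => // a b ab.
have [ag bf] : (forall n, D n -> '<| a, g n |> = 0) /\
    (forall n, D n -> '<| b, f n |> = 0).
  by split=> n Dn; have [] := ab _ _ _ (s1 n Dn) (Ag n Dn) (Af n Dn).
have Aa : A a = 0.
  by apply: hdot_inj => y; rewrite hdot0l A_dot0// => k Dk; rewrite ag// mul0r.
have Ab : Aadj b = 0.
  apply: hdot_injr => x; rewrite hdot0r -adjointP// A_dot0// => k Dk.
  by rewrite (hdot_eq0C (bf _ _))// mulr0.
split; apply: hdot_eq0.
  by have [] := ab 0 0 a zero01; rewrite ?scale0r.
by have [] := ab 0 b 0 zero01; rewrite ?scale0r ?linear0.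
Qed.

(** If [z] is orthogonal to the eigenvectors of [Aadj A], then [(z, 0)] is
    orthogonal to the given basis, whose first components are such eigenvectors
    or zero. *)
Lemma diagonalizable_AadjA_basis :
  diagonalizable_operator (flip_operator V \o julia_operator A) ->
  exists2 G, orthonormal_basis G & G `<=` eigenvector (Aadj \o A).
Proof.
move=> [E [E_basis EU]].
have [T TE] : exists T : {linear V -> V}, Aadj \o A = T.
  by apply: linear_fun_ex => a x y /=; rewrite linearP adjoint_linear.
have Tsa := AadjA_selfadjoint A1.
have ET e := @eigenbasis_AadjA _ _ A A1 E e E_basis EU.
rewrite TE in Tsa *.
have {}ET e : E e -> exists a : C, T e.1 = a *: e.1.
  by move=> /ET [a Te]; exists a; rewrite -TE.
have [z zX|G G_basis GX] := orthonormal_eigenbasis Tsa; last first.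
  by exists G => // x /GX[].
have : ((z, 0) : hsum V V) = 0.
  apply: (proj1 (dense_lspanP E) E_basis.2) => e Ee.
  rewrite -[LHS]/('<| z, e.1 |> + '<| 0, e.2 |>) hdot0l addr0.
  have [->|e10] := eqVneq e.1 0; first by rewrite hdot0r.
  by apply: zX; split; split=> //; exact: ET.
by move=> [].
Qed.

(** The vectors [A g], for [g] in an orthonormal basis of eigenvectors of
    [Aadj A], are orthogonal, and applying [A] to the Fourier series of [h]
    gives the Schmidt series. *)
Lemma diagonalizable_schmidt : separable_space V ->
  diagonalizable_operator (flip_operator V \o julia_operator A) ->
  schmidt_decomposable A.
Proof.
move=> sepV /diagonalizable_AadjA_basis[G [G_on /dense_lspanP G_tot] G_eig].
have /countable_injP[phi phi_inj] := orthonormal_countable sepV G_on.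
(* [e] enumerates [G], with zeros at the numbers that [phi] misses. *)
have /choice[e eP] : forall n, exists y,
    (G y /\ phi y = n) \/ (y = 0 /\ forall x, G x -> phi x <> n).
  move=> n; have [[x [Gx xn]]|no] := EM (exists x, G x /\ phi x = n).
    by exists x; left.
  by exists 0; right; split=> // x Gx xn; apply: no; exists x.
have eG n : e n != 0 -> G (e n).
  by case: (eP n) => [[]//|[-> _]]; rewrite eqxx.
have e_neq m n : m != n -> '<| e m, e n |> = 0.
  case: (eP m) => [[Gm mE]|[-> _]]; last by rewrite hdot0l.
  case: (eP n) => [[Gn nE]|[-> _]]; last by rewrite hdot0r.
  move=> mn; rewrite G_on//; case: eqP => // emn.
  by rewrite -mE emn nE eqxx in mn.
have e_unit n : e n != 0 -> '<| e n, e n |> = 1.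
  by move=> /eG Gn; rewrite G_on// eqxx.
have e_dense : dense (lspan (range e)).
  apply/dense_lspanP => x xe; apply: G_tot => y Gy; apply: xe.
  exists (phi y) => //; case: (eP (phi y)) => [[Ge]|[_ /(_ y Gy)//]].
  by apply: phi_inj; rewrite inE.
have Ae_orth m n : m != n -> '<| A (e m), A (e n) |> = 0.
  move=> mn; rewrite adjointP//.
  have [->|/eG/G_eig[_ [a]]] := eqVneq (e n) 0; last first.
    by move=> /= ->; rewrite hdotZr e_neq// mulr0.
  by rewrite -adjointP// linear0 hdot0r.
pose s n : R := complex.Re `|A (e n)|.
have sE n : (s n)%:C = `|A (e n)| by rewrite RRe_real.
exists [set n | A (e n) != 0], s, (fun n => (s n)%:C^-1 *: A (e n)), e; split.
- move=> m n /= Am An; have [<-|mn] := eqVneq m n; last first.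
    by rewrite hdotZl hdotZr Ae_orth// !mulr0.
  rewrite -hdot_norm normrZ normfV sE normr_id mulVf ?expr1n//.
  by rewrite normr_eq0.
- move=> m n /= Am An; have [<-|mn] := eqVneq m n; last exact: e_neq.
  by apply: e_unit; apply: contra_neq Am => ->; rewrite linear0.
- by move=> n /= An; rewrite -ltcR sE normr_gt0.
move=> h; have := fourier_series (h := h) e_neq e_unit e_dense.
move=> /(nonexpansive_cvg A1); apply: cvg_trans.
apply: near_eq_cvg; apply: nearW => N /=.
rewrite linear_sum [RHS]big_mkcond; apply: eq_bigr => n _ /=.
rewrite mem_setE linearZ/=; case: ifPn => [An|/negPn/eqP->]; last by rewrite scaler0.
by rewrite /rank1 !scalerA mulrAC mulfV ?mul1r// sE normr_eq0.
Qed.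

End SchmidtDecomposition.

Theorem proposition7p1 (R : realType) (V : hilbertType R)
    (A : {linear V -> V}) (sepV : separable_space V) (contrA : contraction_operator A) :
  schmidt_decomposable A <->
  diagonalizable_operator (flip_operator V \o julia_operator A).
Proof.
have A1 := contraction_nonexpansive contrA.
split; first exact: schmidt_diagonalizable.
exact: diagonalizable_schmidt.
Qed.
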